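(* Let $q$ be a positive integer with $\gcd(q,6)=1$, and let $f_1,f_2,f_3$ be real-valued functions on $\mathbb Z_q^*$. Then for every $n\in\mathbb Z_q$ there exist $x,y,z\in\mathbb Z_q^*$ such that $n=x+y+z$ (in $\mathbb Z_q$) and $$f_1(x)+f_2(y)+f_3(z)\geqslant\frac{1}{\phi(q)}\sum_{a\in\mathbb Z_q^*}\bigl(f_1(a)+f_2(a)+f_3(a)\bigr),$$ where $\phi$ is Euler's totient function.
   Context: $\mathbb Z_q=\mathbb Z/q\mathbb Z$ and $\mathbb Z_q^*=\{b\in\mathbb Z_q:\gcd(b,q)=1\}$. *)

(* Defs.v *)
From HB Require Import structures.
From mathcomp Require Import all_boot all_order all_algebra.
From mathcomp Require Import reals.

Set Implicit Arguments.
Unset Strict Implicit.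
Unset Printing Implicit Defensive.

Import Order.TTheory GRing.Theory Num.Theory.

Local Open Scope ring_scope.

(* For q > 0 this is {0, ..., q - 1} with MathComp's addition modulo q.
   MathComp's 'Z_q is not used because 'Z_1 has two elements, whereas q = 1
   must be allowed here. *)
Notation Zmod q := 'I_q.-1.+1.

(* For q = 1 this contains 0, since gcd(0, 1) = 1. *)
Notation Zmod_units q := {b : Zmod q | coprime b q}.

(* Main.v *)
(** If [(x, y, z)] is a random triple of units with [x + y + z = n] whose three
    marginals are uniform, then [f1 x + f2 y + f3 z] has the required
    expectation, so some triple is as wanted. Modulo a prime [p >= 5] such a
    distribution has density proportional to
    [p - 1 - [x = n] - [y = n] - [z = n]]; more generally this works for the
    nonzero elements of any finite abelian group of order at least 4. The
    property passes to products and to preimages under surjective morphisms,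
    and the units modulo [q = p ^ k * m], with [m] prime to [p], are the
    preimage of the units of [Z_p x Z_m]. *)
Require Import Defs.
From HB Require Import structures.
From mathcomp Require Import all_boot all_order all_algebra.
From mathcomp Require Import reals.
From mathcomp Require Import ring lra.

Set Implicit Arguments.
Unset Strict Implicit.
Unset Printing Implicit Defensive.

Import Order.TTheory GRing.Theory Num.Theory.

Local Open Scope ring_scope.

(** Multiplying through by [#|U|] avoids division, and taking functions on all of [G] avoids
    subtypes; only their values on [U] enter. *)
Definition sums_beat_average (R : realType) (G : finZmodType) (U : {set G}) :=
  forall (f1 f2 f3 : G -> R) (n : G),
  exists x y z : G, [/\ x \in U, y \in U, z \in U, x + y + z = n &
    \sum_(a in U) (f1 a + f2 a + f3 a) <= #|U|%:R * (f1 x + f2 y + f3 z)].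

(** Otherwise [g i < 0] wherever [w i > 0], and the weighted sum would be negative. In the
    applications [g] is a scaled deviation from the average. *)
Lemma exists_ge0_weighted_sum0 (R : realType) (I : finType) (w g : I -> R) :
  (forall i, 0 <= w i) -> 0 < \sum_i w i -> \sum_i w i * g i = 0 ->
  exists i, 0 < w i /\ 0 <= g i.
Proof.
move=> w_ge0 w_gt0 wg0.
have [/existsP[i /andP[wi gi]]|] := boolP [exists i, (0 < w i) && (0 <= g i)].
  by exists i.
rewrite negb_exists => /forallP neg.
have neg_ge0 i : true -> 0 <= - (w i * g i).
  move=> _; have := neg i; rewrite negb_and -leNgt -ltNge => /orP[w_le0|g_lt0].
    by rewrite (_ : w i = 0) ?mul0r ?oppr0//; apply/eqP; rewrite eq_le w_le0 w_ge0.
  by rewrite oppr_ge0 mulr_ge0_le0 // ltW.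
have sum0 : \sum_i - (w i * g i) = 0 by rewrite sumrN wg0 oppr0.
have all0 := psumr_eq0P neg_ge0 sum0.
move: w_gt0; rewrite big1 ?ltxx // => i _; apply/eqP.
have /eqP := all0 i isT; rewrite oppr_eq0 mulf_eq0 => /orP[//|/eqP gi0].
by have := neg i; rewrite gi0 lexx andbT -leNgt eq_le w_ge0 => ->.
Qed.

Lemma sum_indicator (R : pzSemiRingType) (T : finType) (a : T) (F : T -> R) :
  \sum_y (y == a)%:R * F y = F a.
Proof.
rewrite (bigD1 a) //= eqxx mul1r big1 ?addr0 // => y /negPf ->.
by rewrite mul0r.
Qed.

(** * Nonzero elements of a finite abelian group *)

Section NonzeroElements.
Variables (R : realType) (G : finZmodType) (n : G).

(** A nonzero [x] leaves [#|G| - 1] choices of [y] with [y] and [n - x - y] nonzero if [x = n], and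
    [#|G| - 2] otherwise. The term [(x == n)%:R] offsets this; the other two make the weight
    symmetric. *)
Definition nonzero_weight (x y z : G) : R :=
  (x != 0)%:R * (y != 0)%:R * (z != 0)%:R *
  (#|G|%:R - 1 - (x == n)%:R - (y == n)%:R - (z == n)%:R).

Definition nonzero_marginal : R := (#|G|%:R - 1) * (#|G|%:R - 2) - 2 * (n != 0)%:R.

(** Without the corrections at [y] and [z], the sum for [x != 0] is [(#|G| - 1) * (#|G| - 2)]
    whether or not [x = n]; those corrections subtract 1 each when [n != 0]. *)
Lemma nonzero_weight_marginal (x : G) :
  \sum_y nonzero_weight x y (n - x - y) = (x != 0)%:R * nonzero_marginal.
Proof.
have [->|x0] := eqVneq x 0.
  by rewrite mul0r big1 // => y _; rewrite /nonzero_weight eqxx !mul0r.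
have z0 y : (n - x - y == 0) = (y == n - x) by rewrite subr_eq0 eq_sym.
have zn y : (n - x - y == n) = (y == - x).
  by rewrite subr_eq -subr_eq0 opprD addrACA subrr add0r -opprD oppr_eq0 addrC addr_eq0.
have nxn : (n - x == n) = false.
  by rewrite subr_eq -subr_eq0 opprD addrA subrr add0r oppr_eq0; apply/negbTE.
have nx0 : (n - x == 0) = (x == n) by rewrite subr_eq0 eq_sym.
(* For [x != 0], the case [y = n] is admissible (all coordinates nonzero) exactly
   when [n != 0], and so is the case [z = n], that is, [y = - x]. *)
have weightE y : nonzero_weight x y (n - x - y) =
    (#|G|%:R - 1 - (x == n)%:R) * (1 - (y == 0)%:R - (y == n - x)%:R * (x != n)%:R)
    - (y == n)%:R * (n != 0)%:R - (y == - x)%:R * (n != 0)%:R.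
  (* Inclusion-exclusion: the events [y = 0] and [y = n - x] coincide if [x = n] and are disjoint
     otherwise. *)
  have yz : (y != 0)%:R * (y != n - x)%:R =
      1 - (y == 0)%:R - (y == n - x)%:R * (x != n)%:R :> R.
    have [->|y0] := eqVneq y 0.
      by rewrite (eq_sym 0) nx0; case: (x == n) => /=; ring.
    have [ynx|_] := eqVneq y (n - x); last by rewrite /=; ring.
    by rewrite -nx0 -ynx y0 /=; ring.
  have yzyn : (y != 0)%:R * (y != n - x)%:R * (y == n)%:R =
      (y == n)%:R * (n != 0)%:R :> R.
    by have [->|_] := eqVneq y n; rewrite ?mulr0 ?mul0r // (eq_sym n (n - x)) nxn !mulr1 mul1r.
  have yzzn : (y != 0)%:R * (y != n - x)%:R * (y == - x)%:R =
      (y == - x)%:R * (n != 0)%:R :> R.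
    have [->|_] := eqVneq y (- x); rewrite ?mulr0 ?mul0r //.
    by rewrite oppr_eq0 x0 -[X in X != n - x]add0r (inj_eq (addIr _)) eq_sym !mul1r mulr1.
  by rewrite /nonzero_weight z0 zn x0 mul1r -yz -yzyn -yzzn; ring.
under eq_bigr do rewrite weightE.
rewrite !sumrB -mulr_sumr !sumrB sumr_const !sum_indicator.
have -> : \sum_(y : G) (y == 0)%:R = 1 :> R.
  under eq_bigr do rewrite -[_%:R]mulr1.
  exact: sum_indicator.
rewrite /nonzero_marginal mul1r; case: eqP => _ /=; ring.
Qed.

Lemma nonzero_weightC (x y z : G) : nonzero_weight x y z = nonzero_weight y x z.
Proof. by rewrite /nonzero_weight; ring. Qed.

Lemma nonzero_weightCr (x y z : G) : nonzero_weight x y z = nonzero_weight x z y.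
Proof. by rewrite /nonzero_weight; ring. Qed.

Lemma sum_weight_l (f : G -> R) :
  \sum_x \sum_y nonzero_weight x y (n - x - y) * f x =
  nonzero_marginal * \sum_(x in ~: [set 0]) f x.
Proof.
under eq_bigr do rewrite -mulr_suml nonzero_weight_marginal.
rewrite [in RHS]big_mkcond mulr_sumr; apply: eq_bigr => x _.
by rewrite !inE; case: eqP => _ /=; ring.
Qed.

Lemma sum_weight_m (f : G -> R) :
  \sum_x \sum_y nonzero_weight x y (n - x - y) * f y =
  nonzero_marginal * \sum_(x in ~: [set 0]) f x.
Proof.
rewrite exchange_big -sum_weight_l; apply: eq_bigr => y _; apply: eq_bigr => x _.
by rewrite nonzero_weightC addrAC.
Qed.

(** For fixed [x] the involution [y -> n - x - y] swaps the second and third coordinates, and the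
    weight is symmetric. *)
Lemma sum_weight_r (f : G -> R) :
  \sum_x \sum_y nonzero_weight x y (n - x - y) * f (n - x - y) =
  nonzero_marginal * \sum_(x in ~: [set 0]) f x.
Proof.
rewrite -sum_weight_m; apply: eq_bigr => x _.
have K : involutive (fun y => n - x - y) by move=> y; rewrite opprB addrC subrK.
rewrite (reindex_inj (inv_inj K)); apply: eq_bigr => y _.
by rewrite K nonzero_weightCr.
Qed.

(** The last factor is smallest at [x = y = z = n], where it equals [#|G| - 4]. *)
Lemma nonzero_weight_ge0 (x y z : G) : (4 <= #|G|)%N -> 0 <= nonzero_weight x y z.
Proof.
move=> G4; have {}G4 : 4 <= #|G|%:R :> R by rewrite (ler_nat R 4).
rewrite /nonzero_weight !mulr_ge0 //.
by case: (x == n); case: (y == n); case: (z == n) => /=; lra.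
Qed.

Lemma nonzero_marginal_gt0 : (4 <= #|G|)%N -> 0 < nonzero_marginal.
Proof.
move=> G4; have {}G4 : 4 <= #|G|%:R :> R by rewrite (ler_nat R 4).
by rewrite /nonzero_marginal; case: (n != 0) => /=; nra.
Qed.

End NonzeroElements.

Lemma sums_beat_average_nonzero (R : realType) (G : finZmodType) :
  (4 <= #|G|)%N -> sums_beat_average R (~: [set 0 : G]).
Proof.
move=> G4 f1 f2 f3 n; set U := ~: _; set S := \sum_(a in U) _.
pose z (p : G * G) := n - p.1 - p.2.
pose w p := nonzero_weight R n p.1 p.2 (z p).
pose c := nonzero_marginal R n.
have c_gt0 : 0 < c by apply: nonzero_marginal_gt0.
have sumw : \sum_p w p = c * #|U|%:R.
  rewrite -(pair_bigA _ (fun x y => w (x, y))) /= -sumr_const -(sum_weight_l n (fun=> 1)).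
  by apply: eq_bigr => x _; apply: eq_bigr => y _; rewrite mulr1.
have U_gt0 : 0 < #|U|%:R :> R.
  by rewrite ltr0n cardsC1 -ltnS prednK ?(leq_trans _ G4).
have sumwf : \sum_p w p * (f1 p.1 + f2 p.2 + f3 (z p)) = c * S.
  rewrite /S !big_split !mulrDr -sum_weight_l -sum_weight_m -sum_weight_r.
  rewrite !pair_bigA /= -!big_split /=; apply: eq_bigr => -[x y] _.
  by rewrite /w /z /=; ring.
have [|||[x y] [wxy gxy]] := @exists_ge0_weighted_sum0 R _ w
  (fun p => #|U|%:R * (f1 p.1 + f2 p.2 + f3 (z p)) - S).
- by move=> p; apply: nonzero_weight_ge0.
- by rewrite sumw mulr_gt0.
- under eq_bigr do rewrite mulrBr mulrCA.
  by rewrite sumrB -mulr_sumr -mulr_suml sumw sumwf; ring.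
exists x, y, (n - x - y); move: wxy gxy; rewrite subr_ge0 /w /nonzero_weight /z /= !inE.
(* A zero coordinate would make the weight vanish, contradicting its positivity. *)
have [->|_] := eqVneq x 0; first by rewrite !mul0r ltxx.
have [->|_] := eqVneq y 0; first by rewrite !(mulr0, mul0r) ltxx.
have [->|_] := eqVneq (n - x - y) 0; first by rewrite !(mulr0, mul0r) ltxx.
by split=> //; rewrite -[n - x - y]addrA -opprD subrKC.
Qed.

(* MathComp declares both parents of this structure for pairs, but not the join. *)
HB.instance Definition _ (G H : finZmodType) := GRing.Zmodule.on (G * H)%type.

(** * Products *)

Lemma sums_beat_average_prod (R : realType) (G H : finZmodType)
    (U : {set G}) (V : {set H}) :
  sums_beat_average R U -> sums_beat_average R V ->
  sums_beat_average R (setX U V).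
Proof.
move=> goodU goodV f1 f2 f3 [n m].
(* Sum out the second coordinate to choose [x, y, z], then use the property of [V] on the slices at
   these points. *)
have [x [y [z [xU yU zU xyz le1]]]] := goodU
  (fun a => \sum_(b in V) f1 (a, b)) (fun a => \sum_(b in V) f2 (a, b))
  (fun a => \sum_(b in V) f3 (a, b)) n.
have [x' [y' [z' [xV yV zV xyz' le2]]]] := goodV
  (fun b => f1 (x, b)) (fun b => f2 (y, b)) (fun b => f3 (z, b)) m.
exists (x, x'), (y, y'), (z, z'); split; rewrite ?inE /= ?xU ?yU ?zU //.
  by rewrite -xyz -xyz'.
rewrite cardsX natrM -mulrA.
have -> : \sum_(a in setX U V) (f1 a + f2 a + f3 a) = \sum_(a in U)
   (\sum_(b in V) f1 (a, b) + \sum_(b in V) f2 (a, b) + \sum_(b in V) f3 (a, b)).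
  under [RHS]eq_bigr do rewrite -!big_split /=.
  rewrite pair_big; apply: eq_big => [[a b]|[a b] _] //.
  by rewrite in_setX.
by apply: le_trans le1 _; rewrite ler_wpM2l // -!big_split.
Qed.

(** * Preimages under surjective morphisms *)

Section Preimage.
Variables (G H : finZmodType) (pi : G -> H).
Hypotheses (piD : {morph pi : x y / x + y}) (pi_surj : forall h, exists g, pi g = h).

Let pi0 : pi 0 = 0.
Proof. by apply: (addrI (pi 0)); rewrite -piD !addr0. Qed.

Let piB x y : pi (x - y) = pi x - pi y.
Proof. by apply: (addIr (pi y)); rewrite -piD !subrK. Qed.

Lemma card_fiber (h : H) : #|[pred g | pi g == h]| = #|[pred g | pi g == 0]|.
Proof.
have [g0 <-] := pi_surj h.
rewrite -!sum1_card (reindex_inj (addIr g0)); apply: eq_bigl => g.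
by rewrite !inE piD -[X in _ == X]add0r (inj_eq (addIr _)).
Qed.

Lemma sums_beat_average_preim (R : realType) (V : {set H}) :
  sums_beat_average R V -> sums_beat_average R (pi @^-1: V).
Proof.
move=> goodV f1 f2 f3 n.
pose F (f : G -> R) h := \sum_(g | pi g == h) f g.
pose K := #|[pred g | pi g == 0]|.
have K_gt0 : 0 < K%:R :> R.
  by rewrite ltr0n; apply/card_gt0P; exists 0; rewrite inE pi0.
have sum_fiber f : \sum_(a in pi @^-1: V) f a = \sum_(h in V) F f h.
  rewrite (partition_big pi (mem V)) /= => [|g]; last by rewrite inE.
  apply: eq_bigr => h hV; apply: eq_bigl => g; rewrite inE.
  by case: eqP => [->|]; rewrite ?hV ?andbF.
have sum_const h (c : R) : \sum_(g | pi g == h) c = K%:R * c.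
  by rewrite sumr_const card_fiber mulr_natl.
have cardE : #|pi @^-1: V|%:R = #|V|%:R * K%:R :> R.
  rewrite -[LHS]sumr_const sum_fiber.
  under eq_bigr do rewrite /F sum_const mulr1.
  by rewrite sumr_const mulr_natl.
(* [X, Y, Z] beat the average for the fiber sums; then average over [x] and [y]
   running independently over the fibers of [X] and [Y]. *)
have [X [Y [Z [XV YV ZV XYZ le1]]]] := goodV (F f1) (F f2) (F f3) (pi n).
pose val p := f1 p.1 + f2 p.2 + f3 (n - p.1 - p.2).
pose D p : R := (pi p.1 == X)%:R * (pi p.2 == Y)%:R.
have sumD (g : G * G -> R) : \sum_p D p * g p =
    \sum_(x | pi x == X) \sum_(y | pi y == Y) g (x, y).
  transitivity (\sum_x \sum_y D (x, y) * g (x, y)).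
    by rewrite pair_bigA; apply: eq_bigr => -[].
  rewrite [RHS]big_mkcond.
  apply: eq_bigr => x _; rewrite /D /=; case: ifP => _; last first.
    by rewrite big1 // => y _; rewrite !mul0r.
  rewrite [RHS]big_mkcond; apply: eq_bigr => y _; case: ifP => _.
    by rewrite !mul1r.
  by rewrite mulr0 mul0r.
have sum_val : \sum_p D p * val p = K%:R * (F f1 X + F f2 Y + F f3 Z).
  rewrite sumD /val /=.
  have inner x : pi x == X ->
      \sum_(y | pi y == Y) (f1 x + f2 y + f3 (n - x - y)) = K%:R * f1 x + F f2 Y + F f3 Z.
    move=> /eqP pix; rewrite !big_split sum_const /=; congr (_ + _).
    (* As [pi n = X + Y + Z], this involution exchanges the fibers of [Y] and [Z], so the third
       coordinate is also uniform on its fiber. *)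
    have inv : involutive (fun y => n - x - y) by move=> y; rewrite opprB addrC subrK.
    rewrite /F [RHS](reindex_inj (inv_inj inv)); apply: eq_bigl => y.
    rewrite !piB pix -XYZ -(addrA X) [X + _]addrC addrK.
    by rewrite subr_eq [Z + _]addrC (inj_eq (addIr _)) eq_sym.
  rewrite (eq_bigr _ inner) !big_split !sum_const -mulr_sumr /=.
  by rewrite -/(F f1 X); ring.
have sum_D : \sum_p D p = K%:R * K%:R.
  transitivity (\sum_p D p * 1); first by under [RHS]eq_bigr do rewrite mulr1.
  by rewrite sumD; under eq_bigr do rewrite sum_const; rewrite sum_const; ring.
have [|||[x y] [Dxy gxy]] := @exists_ge0_weighted_sum0 R _ D
  (fun p => K%:R * val p - (F f1 X + F f2 Y + F f3 Z)).
- by move=> p; rewrite /D mulr_ge0.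
- by rewrite sum_D mulr_gt0.
- under eq_bigr do rewrite mulrBr mulrCA.
  by rewrite sumrB -mulr_sumr -mulr_suml sum_D sum_val; ring.
move: Dxy; rewrite /D /=.
have [pix|_] := eqVneq (pi x) X; last by rewrite mul0r ltxx.
have [piy|_] := eqVneq (pi y) Y; last by rewrite mulr0 ltxx.
move=> _; exists x, y, (n - x - y); split; rewrite ?inE ?pix ?piy //.
- by rewrite !piB pix piy -XYZ -(addrA X) [X + _]addrC addrK [Y + Z]addrC addrK.
- by rewrite -[n - x - y]addrA -opprD subrKC.
rewrite sum_fiber cardE -mulrA; apply: (@le_trans _ _ (#|V|%:R * (F f1 X + F f2 Y + F f3 Z))).
  by under eq_bigr do rewrite /F !big_split /= -!/(F _ _).
by rewrite ler_wpM2l // -subr_ge0.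
Qed.

End Preimage.

(** * Residues and units modulo [q] *)

Definition residue (q d : nat) (x : Zmod q) : Zmod d := inZp x.

(** [inZp] reduces modulo [d.-1.+1], which is [d] only when [d] is positive. *)
Lemma residueE (q d : nat) (x : Zmod q) : (0 < d)%N ->
  residue d x = (x %% d)%N :> nat.
Proof. by move=> d_gt0; congr (_ %% _)%N; apply: prednK. Qed.

Lemma residueD (q d : nat) : (0 < q)%N -> (0 < d)%N -> (d %| q)%N ->
  {morph @residue q d : x y / x + y}.
Proof.
move=> q_gt0 d_gt0 dq x y; apply: val_inj => /=.
by rewrite modnDm modn_dvdm // !prednK.
Qed.

(** Strong induction on [q], splitting off the full power of one prime divisor [p]: the cofactor [m]
    is smaller and still prime to 6. *)
Lemma sums_beat_average_units (R : realType) (q : nat) :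
  (0 < q)%N -> coprime q 6 ->
  sums_beat_average R [set x : Zmod q | coprime x q].
Proof.
elim/ltn_ind: q => q IH q_gt0 q6.
have [q1|q_gt1] := leqP q 1.
  have {q1 q_gt0} -> : q = 1%N by apply/eqP; rewrite eqn_leq q1.
  move=> f1 f2 f3 n; exists 0, 0, 0; split; rewrite ?inE //.
    by rewrite !ord1.
  rewrite (_ : [set x | _] = [set 0]) ?big_set1 ?cards1 ?mul1r //.
  by apply/setP => x; rewrite !inE ord1.
have [p p_pr pq] : exists2 p, prime p & (p %| q)%N.
  by exists (pdiv q); [apply: pdiv_prime | apply: pdiv_dvd].
have p_gt0 := prime_gt0 p_pr.
have [m pm] := pfactor_coprime p_pr q_gt0.
have : (0 < logn p q)%N by rewrite logn_gt0 mem_primes p_pr q_gt0.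
move: (logn p q) => k k_gt0 qE.
have m_gt0 : (0 < m)%N by move: q_gt0; rewrite qE; case: (m).
have mq : (m %| q)%N by rewrite qE dvdn_mulr.
(* Coprimality to 6 excludes the primes 2 and 3. *)
have p_ge4 : (4 <= p)%N.
  have p6 := coprime_dvdl pq q6.
  by move: p_pr p6; case: (p) => [|[|[|[|[|]]]]].
have goodm : sums_beat_average R [set x : Zmod m | coprime x m].
  apply: IH => //; last exact: coprime_dvdl mq q6.
  by rewrite qE ltn_Pmulr // -(exp1n k) ltn_exp2r // prime_gt1.
have goodp : sums_beat_average R (~: [set 0 : Zmod p]).
  by apply: sums_beat_average_nonzero; rewrite card_ord prednK.
have := sums_beat_average_prod goodp goodm.
move/(@sums_beat_average_preim _ _ (fun x : Zmod q => (residue p x, residue m x))).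
have -> : (fun x : Zmod q => (residue p x, residue m x)) @^-1:
    setX (~: [set 0]) [set x : Zmod m | coprime x m] = [set x : Zmod q | coprime x q].
  have coprime_residue d (x : Zmod q) : (0 < d)%N -> coprime (residue d x) d = coprime x d.
    by move=> d_gt0; rewrite residueE // coprime_modl.
  apply/setP => x; rewrite !inE coprime_residue //.
  have -> : (residue p x != 0) = coprime x p.
    by rewrite coprime_sym prime_coprime // /dvdn -residueE.
  (* As [k > 0], being prime to [p] and being prime to [p ^ k] agree. *)
  by rewrite -[coprime x p](coprime_pexpr _ _ k_gt0) andbC -coprimeMr -qE.
apply.
- by move=> x y; rewrite !residueD.
(* Surjectivity is the Chinese remainder theorem for the coprime pair [p], [m]. *)
- move=> [a b]; exists (inZp (chinese p m a b)).
  have modp i : (i %% p.-1.+1 = i %% p)%N by rewrite prednK.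
  have modm i : (i %% m.-1.+1 = i %% m)%N by rewrite prednK.
  congr pair; apply: val_inj => /=; rewrite modn_dvdm ?(prednK q_gt0) //.
  - by rewrite -[RHS](modn_small (ltn_ord a)) !modp chinese_modl.
  - by rewrite prednK.
  - by rewrite -[RHS](modn_small (ltn_ord b)) !modm chinese_modr.
  - by rewrite prednK.
Qed.

Theorem theorem1p2 (R : realType) (q : nat) (q_gt0 : (0 < q)%N)
    (q_coprime6 : coprime q 6) (f1 f2 f3 : Zmod_units q -> R) (n : Zmod q) :
  exists x y z : Zmod_units q,
    n = val x + val y + val z /\
    f1 x + f2 y + f3 z >=
      1 / (totient q)%:R * \sum_(a : Zmod_units q) (f1 a + f2 a + f3 a).
Proof.
(* The default 0 off the units is harmless: the sum and the witnesses stay among the units. *)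
pose ext (f : Zmod_units q -> R) b := if insub b is Some u then f u else 0.
have extE f (u : Zmod_units q) : ext f (val u) = f u by rewrite /ext valK.
have [x [y [z [xU yU zU xyz le_avg]]]] :=
  sums_beat_average_units q_gt0 q_coprime6 (ext f1) (ext f2) (ext f3) n.
rewrite !inE in xU yU zU.
exists (Sub x xU), (Sub y yU), (Sub z zU); split; first by rewrite !SubK.
rewrite -!extE !SubK.
have cardU : #|[set x : Zmod q | coprime x q]| = totient q.
  transitivity (\sum_(0 <= d < q.-1.+1) coprime q d)%N.
    rewrite big_mkord -sum1_card big_mkcond; apply: eq_bigr => i _.
    by rewrite coprime_sym inE; case: (coprime _ _).
  by rewrite prednK // totient_count_coprime.
have phi_gt0 : 0 < (totient q)%:R :> R by rewrite ltr0n totient_gt0.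
rewrite mul1r mulrC ler_pdivrMr // mulrC -cardU.
apply: le_trans le_avg; rewrite le_eqVlt; apply/orP; left; apply/eqP.
(* Pass from the set of units to the subtype, with [insub] as partial inverse of [val]. *)
rewrite [RHS](reindex_omap (val : Zmod_units q -> _) insub) => [|b]; last first.
  by rewrite inE => bU; rewrite insubT.
apply: eq_big => [u|u _]; last by rewrite !extE.
by rewrite inE valK eqxx andbT (valP u).
Qed.
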